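(* Let $H$ be an infinite dimensional Hilbert space and let $n\geq 0$ be an integer. Then $\sigma(B(H)^{(2n)})=\emptyset$ and $\sigma(B(H)\oplus B(H)^{(2n)})=\emptyset$.
   Context: $B(H)$ is the Banach algebra of all bounded operators on $H$. For a Banach algebra $A$, $\sigma(A)$ denotes its spectrum (character space), i.e. the set of nonzero multiplicative linear functionals on $A$. $A^{(k)}$ denotes the $k$-th dual space of $A$, with $A^{(0)}=A$. For a Banach algebra $A$, the bidual $A^{**}$ is a Banach algebra under the first Arens product $\square$: $\langle \Phi\square\Psi,f\rangle=\langle\Phi,\Psi\cdot f\rangle$, $\langle\Psi\cdot f,a\rangle=\langle\Psi,f\cdot a\rangle$, $\langle f\cdot a,b\rangle=\langle f,ab\rangle$ for $\Phi,\Psi\in A^{**}$, $f\in A^*$, $a,b\in A$; the even duals $A^{(2n)}$ are made into Banach algebras by iterating this. Each dual $X^*$ of a Banach $A$-bimodule $X$ is a Banach $A$-bimodule via $(a\cdot f)(x)=f(xa)$, $(f\cdot a)(x)=f(ax)$, and iterating this makes $A^{(2n)}$ a Banach $A$-bimodule. The module extension Banach algebra $B(H)\oplus B(H)^{(2n)}$ has product $(a,u)(b,v)=(ab,av+ub)$ and norm $\|(a,u)\|=\|a\|+\|u\|$ for $a,b\in B(H)$, $u,v\in B(H)^{(2n)}$. *)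

(* Defs.v *)
From HB Require Import structures.
From mathcomp Require Import all_boot all_order all_algebra.
From mathcomp Require Import sesquilinear complex.
From mathcomp Require Import boolp classical_sets functions reals.
From mathcomp Require Import topology normedtype.

Set Implicit Arguments.
Unset Strict Implicit.
Unset Printing Implicit Defensive.

Import Order.TTheory GRing.Theory Num.Theory.
Import numFieldNormedType.Exports.

Local Open Scope classical_set_scope.
Local Open Scope ring_scope.
Local Open Scope complex_scope.

(* [numFieldNormedType.Exports] only covers abstract number fields. *)
HB.instance Definition _ (R : realType) := NormedModule.copy R[i] R[i]^o.

Section NormLemmas.
Context (R : realType) (V : normedModType R[i]).

Definition rnorm (x : V) : R := complex.Re `|x|.

Lemma rnormE x : (rnorm x)%:C = `|x|.
Proof. by rewrite RRe_real ?normr_real. Qed.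

Lemma rnorm_ge0 x : 0 <= rnorm x.
Proof. by rewrite -lecR rnormE normr_ge0. Qed.

Lemma posC_ex (e : R[i]) : 0 < e -> exists2 r : R, 0 < r & e = r%:C.
Proof.
move=> e0; exists (complex.Re e); last by rewrite RRe_real ?gtr0_real.
by rewrite -ltcR RRe_real ?gtr0_real.
Qed.

Lemma near_dist_le (T : Type) (F : set_system T) (FF : ProperFilter F)
    (f : T -> V) (a l : V) (M : R) :
  f @ F --> l -> (\forall t \near F, `|a - f t| <= M%:C) -> `|a - l| <= M%:C.
Proof.
move=> fl aM; rewrite -rnormE lecR; apply/ler_addgt0Pr => e e0.
have e0C : 0 < e%:C by rewrite ltcR.
have fle : \forall t \near F, `|l - f t| < e%:C.
  by move/cvgrPdist_lt : fl => /(_ _ e0C).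
have [t [at_ lt_]] := @filter_ex _ _ FF _ (filterI aM fle).
rewrite -lecR rnormE rmorphD /=.
have -> : a - l = (a - f t) - (l - f t) by rewrite opprB addrA subrK.
by rewrite (le_trans (ler_normB _ _))// lerD// ltW.
Qed.

End NormLemmas.

Lemma complex_complete (R : realType) (F : set_system R[i]) :
  ProperFilter F -> cauchy F -> cvg F.
Proof.
move=> FF /cauchy_ballP Fc.
have cvgpF (p : R[i] -> R) :
    (forall x y, (`|p x - p y|)%:C <= `|x - y|) -> cvg (p @ F).
  move=> pB; apply: R_complete; apply/cauchy_ballP => e e0.
  have e0C : 0 < e%:C by rewrite ltcR.
  rewrite near_map2; apply: filterS (Fc _ e0C) => -[x y] /=.
  rewrite -ball_normE /ball_/= => xy.
  suff : `|p x - p y| < e by rewrite -ball_normE.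
  by rewrite -ltcR; apply: le_lt_trans (pB _ _) xy.
have normC_Re (z : R[i]) : (`|complex.Re z|)%:C <= `|z|.
  by rewrite normc_def lecR -sqrtr_sqr ler_wsqrtr// lerDl sqr_ge0.
have normC_Im (z : R[i]) : (`|complex.Im z|)%:C <= `|z|.
  by rewrite normc_def lecR -sqrtr_sqr ler_wsqrtr// lerDr sqr_ge0.
have /cvg_ex[a Fa] : cvg (@complex.Re R @ F).
  apply: cvgpF => -[x1 x2] [y1 y2]; exact: (le_trans _ (normC_Re _)).
have /cvg_ex[b Fb] : cvg (@complex.Im R @ F).
  apply: cvgpF => -[x1 x2] [y1 y2]; exact: (le_trans _ (normC_Im _)).
apply/cvg_ex; exists (a +i* b); apply/cvgrPdist_lt => e /posC_ex[r r0 ->].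
have r20 : 0 < r / 2 by rewrite divr_gt0.
move/cvgrPdist_lt : Fa => /(_ _ r20) Fa; move/cvgrPdist_lt : Fb => /(_ _ r20) Fb.
apply: filterS2 Fa Fb => -[x y] /= ax by_.
have -> : (a +i* b) - (x +i* y) = (a - x)%:C + 'i%C * (b - y)%:C.
  by rewrite [LHS]complexE /=.
rewrite (le_lt_trans (ler_normD _ _))// normrM.
have norm_real (t : R) : `|t%:C| = `|t|%:C :> R[i].
  by rewrite normc_def /= expr0n /= addr0 sqrtr_sqr.
have -> : `|'i%C| = 1 :> R[i].
  by rewrite normc_def /= expr0n /= add0r expr1n sqrtr1.
by rewrite mul1r !norm_real -rmorphD ltcR [r]splitr ltrD.
Qed.

HB.instance Definition _ (R : realType) :=
  Uniform_isComplete.Build R[i] (@complex_complete R).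

Section BoundedOperators.
Context (R : realType) (V W : normedModType R[i]).

Definition bounded_linear : {pred V -> W} :=
  fun f => `[< linear f /\ exists M : R, forall x, `|f x| <= M%:C * `|x| >].

Lemma bounded_linear_submod : submod_closed bounded_linear.
Proof.
split=> [|a f g /asboolP[lf [M Mf]] /asboolP[lg [N Ng]]].
  apply/asboolP; split; first by move=> a x y; rewrite scaler0 addr0.
  by exists 0 => x; rewrite normr0 mul0r.
apply/asboolP; split.
  move=> b x y; rewrite !fctE /= lf lg !scalerDr !scalerA (mulrC a) -!addrA.
  by congr (_ + _); rewrite addrCA.
exists (rnorm a * M + N) => x; rewrite !fctE rmorphD rmorphM /=.
rewrite (rnormE a).
rewrite mulrDl -mulrA.
rewrite (le_trans (ler_normD _ _))// lerD// normrZ.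
by rewrite ler_wpM2l.
Qed.

HB.instance Definition _ :=
  GRing.isSubmodClosed.Build R[i] (V -> W) bounded_linear bounded_linear_submod.

Record bop : Type := Bop { bop_fun :> V -> W; _ : bop_fun \in bounded_linear }.

HB.instance Definition _ := [isSub for bop_fun].
HB.instance Definition _ := [Choice of bop by <:].
HB.instance Definition _ := [SubChoice_isSubLmodule of bop by <:].

Lemma bop_ext (f g : bop) : f =1 g -> f = g.
Proof. by move=> fg; apply/val_inj/funext. Qed.

Lemma bop_linear (f : bop) : linear f.
Proof. by case: f => f /= /asboolP[]. Qed.

Lemma bop_bounded (f : bop) :
  exists2 M : R, 0 <= M & forall x, `|f x| <= M%:C * `|x|.
Proof.
case: f => f /= /asboolP[_ [M Mf]]; exists `|M| => // x.
by rewrite (le_trans (Mf x))// ler_wpM2r// lecR ler_norm.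
Qed.

HB.instance Definition _ (f : bop) :=
  GRing.isLinear.Build R[i] V W *:%R f (bop_linear f).

Lemma bopD (f g : bop) x : (f + g) x = f x + g x. Proof. by []. Qed.
Lemma bopZ a (f : bop) x : (a *: f) x = a *: f x. Proof. by []. Qed.
Lemma bopB (f g : bop) x : (f - g) x = f x - g x. Proof. by []. Qed.
Lemma bop0 x : (0 : bop) x = 0. Proof. by []. Qed.

(* Norms of [R[i]]-normed modules are [R[i]]-valued, hence the embedding [%:C];
   [rnorm x] is the norm of [x] as an element of [R]. *)
Definition opnorm (f : bop) : R[i] :=
  (sup [set rnorm (f x) | x in [set x | `|x| <= 1]])%:C.

Lemma opnorm_has_sup (f : bop) :
  has_sup [set rnorm (f x) | x in [set x | `|x| <= 1]].
Proof.
split; first by exists (rnorm (f 0)), 0 => //=; rewrite normr0.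
have [M M0 Mf] := bop_bounded f; exists M => _ [x /= x1 <-].
by rewrite -lecR rnormE (le_trans (Mf x))// ler_piMr// ler0c.
Qed.

Lemma opnorm_ge0 f : 0 <= opnorm f.
Proof.
rewrite ler0c (le_trans (rnorm_ge0 (f 0)))// ub_le_sup//.
  exact: (opnorm_has_sup f).2.
by exists 0 => //=; rewrite normr0.
Qed.

Lemma le_opnorm (f : bop) x : `|f x| <= opnorm f * `|x|.
Proof.
have [->|x0] := eqVneq x 0; first by rewrite linear0 !normr0 mulr0.
rewrite -ler_pdivrMr ?normr_gt0//.
have -> : `|f x| / `|x| = `|f (`|x|^-1 *: x)|.
  by rewrite linearZ normrZ normfV normr_id mulrC.
rewrite -rnormE lecR ub_le_sup//; first exact: (opnorm_has_sup f).2.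
by exists (`|x|^-1 *: x) => //=; rewrite normfZV.
Qed.

Lemma opnorm_le (f : bop) (M : R[i]) :
  0 <= M -> (forall x, `|f x| <= M * `|x|) -> opnorm f <= M.
Proof.
move=> M0 Mf; rewrite -[M]RRe_real ?ger0_real// lecR.
apply: ge_sup; first exact: (opnorm_has_sup f).1.
move=> _ [x /= x1 <-].
rewrite -lecR rnormE RRe_real ?ger0_real//.
by rewrite (le_trans (Mf x))// ler_piMr.
Qed.

Lemma opnormD f g : opnorm (f + g) <= opnorm f + opnorm g.
Proof.
apply: opnorm_le => [|x]; first by rewrite addr_ge0 ?opnorm_ge0.
by rewrite mulrDl (le_trans (ler_normD _ _))// lerD ?le_opnorm.
Qed.

Lemma opnormZ_le a f : opnorm (a *: f) <= `|a| * opnorm f.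
Proof.
apply: opnorm_le => [|x]; first by rewrite mulr_ge0 ?opnorm_ge0.
by rewrite bopZ normrZ -mulrA ler_wpM2l// le_opnorm.
Qed.

Lemma opnormZ a f : opnorm (a *: f) = `|a| * opnorm f.
Proof.
apply/le_anti; rewrite opnormZ_le/=.
have [->|a0] := eqVneq a 0; first by rewrite normr0 mul0r opnorm_ge0.
rewrite -ler_pdivlMl ?normr_gt0// -normfV (le_trans _ (opnormZ_le _ _))//.
by rewrite scalerA mulVf// scale1r.
Qed.

Lemma opnorm0_eq0 f : opnorm f = 0 -> f = 0.
Proof.
move=> f0; apply: bop_ext => x; apply/eqP; rewrite -normr_le0.
by rewrite (le_trans (le_opnorm f x))// f0 mul0r.
Qed.

HB.instance Definition _ :=
  Lmodule_isNormed.Build R[i] bop opnormD opnormZ opnorm0_eq0.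

Lemma bop_normE (f : bop) : `|f| = opnorm f. Proof. by []. Qed.

Lemma ler_bop (f : bop) x : `|f x| <= `|f| * `|x|.
Proof. exact: le_opnorm. Qed.

Lemma bop_norm_le (f : bop) (M : R[i]) :
  0 <= M -> (forall x, `|f x| <= M * `|x|) -> `|f| <= M.
Proof. exact: opnorm_le. Qed.

Lemma bop_mem (f : V -> W) (M : R[i]) :
  0 <= M -> linear f -> (forall x, `|f x| <= M * `|x|) -> f \in bounded_linear.
Proof.
move=> M0 lf Mf; apply/asboolP; split=> //; exists (complex.Re M) => x.
by rewrite RRe_real ?ger0_real.
Qed.

End BoundedOperators.

Section BopComplete.
Context (R : realType) (V : normedModType R[i]) (W : completeNormedModType R[i]).

Lemma bop_complete (F : set_system (bop V W)) :
  ProperFilter F -> cauchy F -> cvg F.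
Proof.
move=> FF /cauchy_ballP Fc.
have Fd (e : R[i]) : 0 < e ->
    \forall f & g \near F,
      forall x, `|(f : bop V W) x - (g : bop V W) x| <= e * `|x|.
  move=> e0; apply: filterS (Fc _ e0) => -[f g] /=.
  rewrite -ball_normE /ball_/= => fg x.
  by rewrite -bopB (le_trans (ler_bop _ _))// ler_wpM2r// ltW.
have Fcv x : cvg ((fun f : bop V W => f x) @ F).
  apply: cauchy_cvg; apply/cauchy_ballP => e e0.
  have x0 : 0 < `|x| + 1 by rewrite ltr_wpDl.
  have ex0 : 0 < e / (`|x| + 1) by rewrite divr_gt0.
  rewrite near_map2; apply: filterS (Fd _ ex0) => -[f g] /= /(_ x) fg.
  suff : `|f x - g x| < e by rewrite -ball_normE.
  rewrite (le_lt_trans fg)// -mulrA gtr_pMr//.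
  by rewrite mulrC ltr_pdivrMr// mul1r ltrDl.
pose h x : W := lim ((fun f : bop V W => f x) @ F).
have Fh x : (fun f : bop V W => f x) @ F --> h x by exact: Fcv.
have lh : linear h.
  move=> a x y; apply: cvg_lim; first exact: norm_hausdorff.
  rewrite (_ : (fun f : bop V W => f (a *: x + y)) =
               (fun f : bop V W => a *: f x + f y)); last first.
    by apply/funext => f; rewrite linearP.
  by apply: cvgD => //; apply: cvgZl_tmp.
have Fn (e : R) : 0 < e ->
    \forall f \near F, forall x, `|(f : bop V W) x - h x| <= e%:C * `|x|.
  move=> e0; have e0C : 0 < e%:C by rewrite ltcR.
  have := Fd _ e0C => /nearP_dep; apply: filterS => f fg x.
  rewrite -(rnormE x) -rmorphM/=; apply: near_dist_le (Fh x) _.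
  by apply: filterS fg => g /(_ x); rewrite rmorphM /= (rnormE x).
have hb : h \in @bounded_linear R V W.
  have [f fh] := @filter_ex _ _ FF _ (Fn 1 ltr01).
  apply: (@bop_mem _ _ _ _ (`|f| + 1)) => // [|x]; first by rewrite addr_ge0.
  rewrite mulrDl -[h x](subrK (f x)) (le_trans (ler_normD _ _))// addrC.
  by rewrite lerD ?ler_bop// distrC.
apply/cvg_ex; exists (Bop hb); apply/cvgrPdist_lt => e /posC_ex[r r0 ->].
have r20 : 0 < r / 2 by rewrite divr_gt0.
apply: filterS (Fn _ r20) => f fh.
apply: (@le_lt_trans _ _ (r / 2)%:C); last first.
  by rewrite ltcR ltr_pdivrMr// ltr_pMr// ltr1n.
apply: bop_norm_le => [|x]; first by rewrite ler0c ltW.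
by rewrite bopB distrC.
Qed.

HB.instance Definition _ := Uniform_isComplete.Build (bop V W) bop_complete.

End BopComplete.

Section MkBop.
Context (R : realType) (V W : normedModType R[i]).
Variables (f : V -> W) (M : R[i]).
Hypotheses (M0 : 0 <= M) (lf : linear f) (fM : forall x, `|f x| <= M * `|x|).

Definition mk_bop : bop V W := Bop (bop_mem M0 lf fM).

Lemma mk_bop_norm : `|mk_bop| <= M.
Proof. exact: bop_norm_le. Qed.

End MkBop.

(* The library norm on [V * W] is the maximum of the norms; [l1sum V W] is the
   same vector space with the norm |x| + |y|. *)
Definition l1sum (V W : Type) : Type := (V * W)%type.

Section L1Sum.
Context (R : realType) (V W : completeNormedModType R[i]).

HB.instance Definition _ := GRing.Lmodule.copy (l1sum V W) (V * W)%type.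

Definition l1norm (x : l1sum V W) : R[i] := `|x.1| + `|x.2|.

Lemma l1normD x y : l1norm (x + y) <= l1norm x + l1norm y.
Proof. by rewrite /l1norm addrACA lerD ?ler_normD. Qed.

Lemma l1normZ a x : l1norm (a *: x) = `|a| * l1norm x.
Proof. by rewrite /l1norm mulrDr -!normrZ. Qed.

Lemma l1norm_eq0 x : l1norm x = 0 -> x = 0.
Proof.
move/eqP; rewrite paddr_eq0// !normr_eq0 => /andP[/eqP x1 /eqP x2].
by case: x x1 x2 => x1 x2 /= -> ->.
Qed.

HB.instance Definition _ :=
  Lmodule_isNormed.Build R[i] (l1sum V W) l1normD l1normZ l1norm_eq0.

Lemma l1_normE (x : l1sum V W) : `|x| = `|x.1| + `|x.2|. Proof. by []. Qed.

Lemma l1_lin1 (k : R[i]) (x y : l1sum V W) : (k *: x + y).1 = k *: x.1 + y.1.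
Proof. by []. Qed.

Lemma l1_lin2 (k : R[i]) (x y : l1sum V W) : (k *: x + y).2 = k *: x.2 + y.2.
Proof. by []. Qed.

Lemma l1_ext (x y : l1sum V W) : x.1 = y.1 -> x.2 = y.2 -> x = y.
Proof. by case: x y => [x1 x2] [y1 y2] /= -> ->. Qed.

Lemma l1sum_complete (F : set_system (l1sum V W)) :
  ProperFilter F -> cauchy F -> cvg F.
Proof.
move=> FF /cauchy_ballP Fc.
have cvgpF (U : completeNormedModType R[i]) (p : l1sum V W -> U) :
    (forall x y, `|p x - p y| <= `|x - y|) -> cvg (p @ F).
  move=> pB; apply: cauchy_cvg; apply/cauchy_ballP => e e0.
  rewrite near_map2; apply: filterS (Fc _ e0) => -[x y] /=.
  rewrite -ball_normE /ball_/= => xy.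
  suff : `|p x - p y| < e by rewrite -ball_normE.
  exact: le_lt_trans (pB _ _) xy.
have /cvg_ex[a Fa] : cvg ((fun x : l1sum V W => x.1) @ F).
  by apply: cvgpF => x y; rewrite [leRHS]l1_normE lerDl.
have /cvg_ex[b Fb] : cvg ((fun x : l1sum V W => x.2) @ F).
  by apply: cvgpF => x y; rewrite [leRHS]l1_normE lerDr.
apply/cvg_ex; exists ((a, b) : l1sum V W).
apply/cvgrPdist_lt => e e0.
have e20 : 0 < e / 2 by rewrite divr_gt0.
move/cvgrPdist_lt : Fa => /(_ _ e20) Fa; move/cvgrPdist_lt : Fb => /(_ _ e20) Fb.
by apply: filterS2 Fa Fb => x ax bx; rewrite l1_normE [e]splitr ltrD.
Qed.

HB.instance Definition _ :=
  Uniform_isComplete.Build (l1sum V W) l1sum_complete.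

End L1Sum.

(* Complex Banach algebras, not necessarily unital. *)
Record banachAlg (R : realType) := BanachAlg {
  balg_space :> completeNormedModType R[i];
  bmul : balg_space -> balg_space -> balg_space;
  bmulA : associative bmul;
  bmul_linearl : forall b, linear (bmul^~ b);
  bmul_linearr : forall a, linear (bmul a);
  bmul_norm : forall a b, `|bmul a b| <= `|a| * `|b| }.

Record banachBimod (R : realType) (A : banachAlg R) := BanachBimod {
  bimod_space :> completeNormedModType R[i];
  lact : A -> bimod_space -> bimod_space;
  ract : bimod_space -> A -> bimod_space;
  lactA : forall a b x, lact (bmul a b) x = lact a (lact b x);
  ractA : forall x a b, ract x (bmul a b) = ract (ract x a) b;
  lract : forall a x b, ract (lact a x) b = lact a (ract x b);
  lact_linearl : forall x, linear (lact^~ x);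
  lact_linearr : forall a, linear (lact a);
  ract_linearl : forall a, linear (ract^~ a);
  ract_linearr : forall x, linear (ract x);
  lact_norm : forall a x, `|lact a x| <= `|a| * `|x|;
  ract_norm : forall x a, `|ract x a| <= `|x| * `|a| }.

Definition dual (R : realType) (V : completeNormedModType R[i]) :
  completeNormedModType R[i] := bop V R[i].

Lemma dual_linE (R : realType) (V : completeNormedModType R[i])
  (c : R[i]) (f g : dual V) x : (c *: f + g) x = c * f x + g x.
Proof. by []. Qed.

Lemma dual_ext (R : realType) (V : completeNormedModType R[i]) (f g : dual V) :
  (forall x, f x = g x) -> f = g.
Proof. exact: bop_ext. Qed.

Section SelfBimod.
Context (R : realType) (A : banachAlg R).

Definition self_bimod : banachBimod A :=
  @BanachBimod R A A (@bmul R A) (@bmul R A)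
    (fun a b x => esym (bmulA a b x)) (@bmulA R A)
    (fun a x b => esym (bmulA a x b))
    (@bmul_linearl R A) (@bmul_linearr R A)
    (@bmul_linearl R A) (@bmul_linearr R A)
    (@bmul_norm R A) (@bmul_norm R A).

End SelfBimod.

(* (a . f)(x) = f (x . a) and (f . a)(x) = f (a . x). *)
Section DualBimod.
Context (R : realType) (A : banachAlg R) (X : banachBimod A).

Lemma dact_linear (f : dual X) (T : X -> X) :
  linear T -> linear (fun x => f (T x)).
Proof. by move=> lT a x y; rewrite lT linearP. Qed.

Lemma dlact_bound (a : A) (f : dual X) x :
  `|f (ract x a)| <= `|f| * `|a| * `|x|.
Proof.
by rewrite (le_trans (ler_bop _ _))// -mulrA ler_wpM2l// mulrC ract_norm.
Qed.

Lemma dract_bound (f : dual X) (a : A) x :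
  `|f (lact a x)| <= `|f| * `|a| * `|x|.
Proof.
by rewrite (le_trans (ler_bop _ _))// -mulrA ler_wpM2l// lact_norm.
Qed.

Definition dual_lact (a : A) (f : dual X) : dual X :=
  @mk_bop R X R[i] (fun x => f (ract x a)) _
    (mulr_ge0 (normr_ge0 f) (normr_ge0 a)) (dact_linear f (@ract_linearl R A X a)) (dlact_bound a f).

Definition dual_ract (f : dual X) (a : A) : dual X :=
  @mk_bop R X R[i] (fun x => f (lact a x)) _
    (mulr_ge0 (normr_ge0 f) (normr_ge0 a)) (dact_linear f (@lact_linearr R A X a)) (dract_bound f a).

Lemma dual_lactE a (f : dual X) x : dual_lact a f x = f (ract x a).
Proof. by []. Qed.

Lemma dual_ractE (f : dual X) a x : dual_ract f a x = f (lact a x).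
Proof. by []. Qed.

Lemma dual_lactA a b f : dual_lact (bmul a b) f = dual_lact a (dual_lact b f).
Proof. by apply: dual_ext => x; rewrite !dual_lactE ractA. Qed.

Lemma dual_ractA f a b : dual_ract f (bmul a b) = dual_ract (dual_ract f a) b.
Proof. by apply: dual_ext => x; rewrite !dual_ractE lactA. Qed.

Lemma dual_lract a f b :
  dual_ract (dual_lact a f) b = dual_lact a (dual_ract f b).
Proof. by apply: dual_ext => x; rewrite !(dual_ractE, dual_lactE) lract. Qed.

Lemma dual_lact_linearl f : linear (dual_lact^~ f).
Proof.
move=> c a b; apply: dual_ext => x.
by rewrite dual_linE !dual_lactE ract_linearr linearP.
Qed.

Lemma dual_lact_linearr a : linear (dual_lact a).
Proof. by move=> c f g; apply: dual_ext => x; rewrite !(dual_linE, dual_lactE). Qed.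

Lemma dual_ract_linearl a : linear (dual_ract^~ a).
Proof. by move=> c f g; apply: dual_ext => x; rewrite !(dual_linE, dual_ractE). Qed.

Lemma dual_ract_linearr f : linear (dual_ract f).
Proof.
move=> c a b; apply: dual_ext => x.
by rewrite dual_linE !dual_ractE lact_linearl linearP.
Qed.

Lemma dual_lact_norm a f : `|dual_lact a f| <= `|a| * `|f|.
Proof. by rewrite mulrC mk_bop_norm. Qed.

Lemma dual_ract_norm f a : `|dual_ract f a| <= `|f| * `|a|.
Proof. exact: mk_bop_norm. Qed.

Definition dual_bimod : banachBimod A :=
  @BanachBimod R A (dual X) dual_lact dual_ract dual_lactA dual_ractA dual_lract
    dual_lact_linearl dual_lact_linearr dual_ract_linearl dual_ract_linearr
    dual_lact_norm dual_ract_norm.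

End DualBimod.

(* First Arens product, with f .r a the functional b |-> f (a b):
   (arens_act Psi f) a = Psi (f .r a) and (arens Phi Psi) f = Phi (arens_act Psi f). *)
Section Arens.
Context (R : realType) (A : banachAlg R).

Local Notation "f .r a" := (dual_ract (X := self_bimod A) f a) (at level 40).

Lemma arens_act_linear (Psi : dual (dual A)) (f : dual A) :
  linear (fun a => Psi (f .r a)).
Proof.
move=> c a b; rewrite -linearP; congr (Psi _); apply: dual_ext => x.
by rewrite dual_linE !dual_ractE /= bmul_linearl linearP.
Qed.

Lemma arens_act_bound (Psi : dual (dual A)) (f : dual A) a :
  `|Psi (f .r a)| <= `|Psi| * `|f| * `|a|.
Proof.
rewrite (le_trans (ler_bop _ _))// -mulrA ler_wpM2l//.
exact: (@dual_ract_norm R A (self_bimod A)).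
Qed.

Definition arens_act (Psi : dual (dual A)) (f : dual A) : dual A :=
  @mk_bop R A R[i] (fun a => Psi (f .r a)) _
    (mulr_ge0 (normr_ge0 Psi) (normr_ge0 f))
    (arens_act_linear Psi f) (arens_act_bound Psi f).

Lemma arens_actE Psi f a : arens_act Psi f a = Psi (f .r a).
Proof. by []. Qed.

Lemma arens_linear (Phi Psi : dual (dual A)) :
  linear (fun f => Phi (arens_act Psi f)).
Proof.
move=> c f g; rewrite -linearP; congr (Phi _); apply: dual_ext => a.
by rewrite dual_linE !arens_actE dual_ract_linearl linearP.
Qed.

Lemma arens_bound (Phi Psi : dual (dual A)) f :
  `|Phi (arens_act Psi f)| <= `|Phi| * `|Psi| * `|f|.
Proof.
by rewrite (le_trans (ler_bop _ _))// -mulrA ler_wpM2l// mk_bop_norm.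
Qed.

Definition arens (Phi Psi : dual (dual A)) : dual (dual A) :=
  @mk_bop R (dual A) R[i] (fun f => Phi (arens_act Psi f)) _
    (mulr_ge0 (normr_ge0 Phi) (normr_ge0 Psi))
    (arens_linear Phi Psi) (arens_bound Phi Psi).

Lemma arensE Phi Psi f : arens Phi Psi f = Phi (arens_act Psi f).
Proof. by []. Qed.

Lemma arensA : associative arens.
Proof.
move=> Phi Psi Theta; apply: dual_ext => f; rewrite !arensE; congr (Phi _).
apply: dual_ext => a; rewrite !arens_actE arensE; congr (Psi _).
apply: dual_ext => b; rewrite !(arens_actE, dual_ractE); congr (Theta _).
by apply: dual_ext => x; rewrite !dual_ractE /= bmulA.
Qed.

Lemma arens_linearl Psi : linear (arens^~ Psi).
Proof.
by move=> c Phi Phi'; apply: dual_ext => f; rewrite !(dual_linE, arensE).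
Qed.

Lemma arens_linearr Phi : linear (arens Phi).
Proof.
move=> c Psi Psi'; apply: dual_ext => f.
rewrite dual_linE !arensE -linearP; congr (Phi _).
by apply: dual_ext => a; rewrite !(dual_linE, arens_actE).
Qed.

Lemma arens_norm Phi Psi : `|arens Phi Psi| <= `|Phi| * `|Psi|.
Proof. exact: mk_bop_norm. Qed.

Definition bidual_alg : banachAlg R :=
  BanachAlg arensA arens_linearl arens_linearr arens_norm.

End Arens.

Section ModuleExtension.
Context (R : realType) (A : banachAlg R) (X : banachBimod A).

Definition ext_mul (p q : l1sum A X) : l1sum A X :=
  (bmul p.1 q.1, lact p.1 q.2 + ract p.2 q.1).

Lemma ext_mul1 p q : (ext_mul p q).1 = bmul p.1 q.1. Proof. by []. Qed.

Lemma ext_mul2 p q : (ext_mul p q).2 = lact p.1 q.2 + ract p.2 q.1.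
Proof. by []. Qed.

Lemma ext_mulA : associative ext_mul.
Proof.
move=> [a u] [b v] [c w]; rewrite /ext_mul /=; congr (_, _).
  exact: bmulA.
have Dl (x y : X) : lact a (x + y) = lact a x + lact a y.
  by have := @lact_linearr R A X a 1 x y; rewrite !scale1r.
have Dr (x y : X) : ract (x + y) c = ract x c + ract y c.
  by have := @ract_linearl R A X c 1 x y; rewrite !scale1r.
by rewrite Dl Dr lactA ractA lract addrA.
Qed.

Lemma ext_mul_linearl q : linear (ext_mul^~ q).
Proof.
move=> k p p'; apply: l1_ext.
  by rewrite !(l1_lin1, ext_mul1) bmul_linearl.
rewrite !(l1_lin1, l1_lin2, ext_mul2) lact_linearl ract_linearl.
by rewrite scalerDr addrACA.
Qed.

Lemma ext_mul_linearr p : linear (ext_mul p).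
Proof.
move=> k q q'; apply: l1_ext.
  by rewrite !(l1_lin1, ext_mul1) bmul_linearr.
rewrite !(l1_lin1, l1_lin2, ext_mul2) lact_linearr ract_linearr.
by rewrite scalerDr addrACA.
Qed.

Lemma ext_mul_norm p q : `|ext_mul p q| <= `|p| * `|q|.
Proof.
move: p q => [a u] [b v]; rewrite !l1_normE /=.
rewrite mulrDl !mulrDr -addrA lerD ?bmul_norm//.
rewrite (le_trans (ler_normD _ _))//.
rewrite lerD ?lact_norm// (le_trans (ract_norm _ _))// lerDl.
by rewrite mulr_ge0.
Qed.

Definition module_ext : banachAlg R :=
  BanachAlg ext_mulA ext_mul_linearl ext_mul_linearr ext_mul_norm.

End ModuleExtension.

Section Operators.
Context (R : realType) (H : completeNormedModType R[i]).

Lemma comp_linear (S T : bop H H) : linear (fun x => S (T x)).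
Proof. by move=> a x y; rewrite !linearP. Qed.

Lemma comp_bound (S T : bop H H) x : `|S (T x)| <= `|S| * `|T| * `|x|.
Proof.
by rewrite (le_trans (ler_bop _ _))// -mulrA ler_wpM2l// ler_bop.
Qed.

Definition bop_comp (S T : bop H H) : bop H H :=
  @mk_bop R H H (fun x => S (T x)) _ (mulr_ge0 (normr_ge0 S) (normr_ge0 T))
    (comp_linear S T) (comp_bound S T).

Lemma bop_compE S T x : bop_comp S T x = S (T x).
Proof. by []. Qed.

Lemma bop_compA : associative bop_comp.
Proof. by move=> S T U; apply: bop_ext => x; rewrite !bop_compE. Qed.

Lemma bop_comp_linearl T : linear (bop_comp^~ T).
Proof. by move=> a S S'; apply: bop_ext => x; rewrite !bop_compE. Qed.

Lemma bop_comp_linearr S : linear (bop_comp S).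
Proof.
move=> a T T'; apply: bop_ext => x.
by rewrite !(bop_compE, bopD, bopZ) linearP.
Qed.

Lemma bop_comp_norm S T : `|bop_comp S T| <= `|S| * `|T|.
Proof. exact: mk_bop_norm. Qed.

Definition operator_alg : banachAlg R :=
  BanachAlg bop_compA bop_comp_linearl bop_comp_linearr bop_comp_norm.

End Operators.

Definition character_space (R : realType) (A : banachAlg R) : set (A -> R[i]) :=
  [set phi | [/\ scalar phi,
                 forall a b, phi (bmul a b) = phi a * phi b
               & exists a, phi a != 0]].
Arguments character_space {R} A _.

(* [A^(2n)] with the iterated first Arens product. *)
Definition even_dual_alg (R : realType) (A : banachAlg R) (n : nat) :
  banachAlg R := iter n (@bidual_alg R) A.

(* [A^(k)] as a Banach A-bimodule. *)
Definition dual_bimod_iter (R : realType) (A : banachAlg R) (k : nat) :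
  banachBimod A := iter k (@dual_bimod R A) (self_bimod A).

Lemma dual_bimod_iter_space (R : realType) (A : banachAlg R) k :
  bimod_space (dual_bimod_iter A k) = iter k (@dual R) A.
Proof.
elim: k => // k IH.
by transitivity (dual (dual_bimod_iter A k)); [reflexivity | rewrite IH].
Qed.

Lemma even_dual_alg_space (R : realType) (A : banachAlg R) n :
  balg_space (even_dual_alg A n) = iter (2 * n) (@dual R) A.
Proof.
elim: n => // n IH; rewrite mulnS.
by transitivity (dual (dual (even_dual_alg A n))); [reflexivity | rewrite IH].
Qed.

Record hilbertSpace (R : realType) := HilbertSpace {
  hilbert_space :> completeNormedModType R[i];
  inner : {dot hilbert_space for Num.Def.conjC};
  inner_norm : forall x, `|x| ^+ 2 = inner x x }.

Definition infinite_dimensional (K : fieldType) (V : lmodType K) : Prop :=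
  ~ exists n (b : 'I_n -> V),
      forall x, exists c : 'I_n -> K, x = \sum_(i < n) c i *: b i.

(* Main.v *)
(* Zorn's lemma gives a maximal orthonormal family of vectors arranged in pairs
   (e_i, f_i).  Let U be the partial isometry e_i |-> f_i, zero on the orthogonal
   complement of the e_i, and V its adjoint.  Then U^2 = 0, and by maximality
   P = 1 - V U - U V has rank at most one; in dimension at least two P is a
   product with a square-zero factor.  A character phi of B(H) kills square-zero
   elements, so phi(U) = phi(P) = 0, whence phi(1) = 0 and phi = 0.  A character
   of the bidual of a unital algebra restricts to a character of the algebra, and
   a character of a module extension kills the square-zero ideal X. *)
Require Import Defs.
From mathcomp Require Import all_boot all_order all_algebra complex.
From mathcomp Require Import sesquilinear finmap.
From mathcomp Require Import boolp classical_sets functions reals.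
From mathcomp Require Import topology normedtype.
From mathcomp Require Import showcase.summability.

Set Implicit Arguments.
Unset Strict Implicit.
Unset Printing Implicit Defensive.

Import Order.TTheory GRing.Theory Num.Theory.
Import numFieldNormedType.Exports.
Local Open Scope classical_set_scope.
Local Open Scope ring_scope.
Local Open Scope complex_scope.
Local Existing Instance totally_filter.

(** * Inner product, orthonormal families, Bessel and Cauchy-Schwarz inequalities *)

Section Hilbert.
Context (R : realType) (H : hilbertSpace R).
Local Notation "<< x , y >>" := (inner H x y).

Lemma innerDl (x y z : H) : <<x + y, z>> = <<x, z>> + <<y, z>>.
Proof. exact: linearDl. Qed.

Lemma innerBl (x y z : H) : <<x - y, z>> = <<x, z>> - <<y, z>>.
Proof. exact: linearBl. Qed.

Lemma innerZl a (x z : H) : <<a *: x, z>> = a * <<x, z>>.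
Proof. exact: linearZl_LR. Qed.

Lemma innerBr (x y z : H) : <<z, x - y>> = <<z, x>> - <<z, y>>.
Proof. exact: linearBr. Qed.

Lemma innerZr a (x z : H) : <<z, a *: x>> = Num.conj a * <<z, x>>.
Proof. exact: linearZr_LR. Qed.

Lemma inner_suml (I : Type) (s : seq I) (F : I -> H) z :
  <<\sum_(i <- s) F i, z>> = \sum_(i <- s) <<F i, z>>.
Proof. exact: linear_sumlz. Qed.

Lemma inner_sumr (I : Type) (s : seq I) (F : I -> H) z :
  <<z, \sum_(i <- s) F i>> = \sum_(i <- s) <<z, F i>>.
Proof. exact: linear_sumr. Qed.

Lemma inner0r z : <<z, 0>> = 0.
Proof. exact: linear0r. Qed.

Lemma inner_conj (x y : H) : <<x, y>> = Num.conj <<y, x>>.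
Proof. by rewrite hermC expr0 mul1r. Qed.

Lemma inner_eq0C (x y : H) : <<x, y>> = 0 -> <<y, x>> = 0.
Proof. by move=> xy; rewrite inner_conj xy rmorph0. Qed.

Definition orthonormal_family (I : eqType) (e : I -> H) :=
  forall i j, <<e i, e j>> = (i == j)%:R.

Section Family.
Context (I : choiceType) (e f : I -> H).
Hypotheses (oe : orthonormal_family e) (of_ : orthonormal_family f).

Lemma inner_fsum (F : {fset I}) (c : I -> R[i]) j : j \in F ->
  <<\sum_(i <- F) c i *: f i, f j>> = c j.
Proof.
move=> jF; rewrite inner_suml (big_fsetD1 j)//= innerZl of_ eqxx mulr1.
rewrite big_seq big1 ?addr0// => i; rewrite !inE => /andP[ij _].
by rewrite innerZl of_ (negbTE ij) mulr0.
Qed.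

Lemma norm_fsum (F : {fset I}) (c : I -> R[i]) :
  `|\sum_(i <- F) c i *: f i| ^+ 2 = \sum_(i <- F) `|c i| ^+ 2.
Proof.
rewrite inner_norm inner_sumr; apply: eq_big_seq => j jF.
by rewrite innerZr inner_fsum// mulrC normCK.
Qed.

End Family.

(** The finite sum [p] is the orthogonal projection of [x]: both [<<x, p>>] and [<<p, x>>] equal
    [|p|^2], so [|x|^2 - |p|^2 = |x - p|^2]. *)
Lemma bessel (I : choiceType) (e : I -> H) (F : {fset I}) (x : H) :
  orthonormal_family e ->
  \sum_(i <- F) `|<<x, e i>>| ^+ 2 <= `|x| ^+ 2.
Proof.
move=> oe; set p := \sum_(i <- F) <<x, e i>> *: e i.
have pE : \sum_(i <- F) `|<<x, e i>>| ^+ 2 = `|p| ^+ 2 by rewrite norm_fsum.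
have xp : <<x, p>> = `|p| ^+ 2.
  rewrite -pE inner_sumr; apply: eq_bigr => i _.
  by rewrite innerZr mulrC normCK.
have px : <<p, x>> = `|p| ^+ 2 by rewrite inner_conj xp geC0_conj// exprn_ge0.
rewrite pE -subr_ge0.
have -> : `|x| ^+ 2 - `|p| ^+ 2 = `|x - p| ^+ 2.
  by rewrite [RHS]inner_norm innerBl !innerBr xp px -!inner_norm subrr subr0.
by rewrite exprn_ge0.
Qed.

Lemma norm1_inner (u : H) : `|u| = 1 -> <<u, u>> = 1.
Proof. by move=> u1; rewrite -inner_norm u1 expr1n. Qed.

(** This is Bessel's inequality for the one-element family [y / |y|], indexed by [unit]. *)
Lemma cauchy_schwarz (x y : H) : `|<<x, y>>| <= `|x| * `|y|.
Proof.
have [->|y0] := eqVneq y 0; first by rewrite inner0r !normr0 mulr0.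
have /norm1_inner u1 : `| `|y|^-1 *: y| = 1 by rewrite normfZV.
set u := _ *: y in u1.
have yE : y = `|y| *: u by rewrite scalerA mulfV ?normr_eq0// scale1r.
rewrite {1}yE innerZr normrM norm_conjC normr_id mulrC ler_wpM2r//.
have ou : @orthonormal_family unit (fun=> u) by move=> [] []; rewrite u1.
have := @bessel unit (fun=> u) [fset tt]%fset x ou.
by rewrite big_seq_fset1 ler_pXn2r ?nnegrE.
Qed.

(** * Linearity rules and rank-one operators *)

Lemma bop_mapZ (T : bop H H) a x : T (a *: x) = a *: T x.
Proof. exact: linearZ_LR. Qed.

Lemma bop_mapB (T : bop H H) x y : T (x - y) = T x - T y.
Proof. exact: linearB. Qed.

Lemma bop_map0 (T : bop H H) : T 0 = 0.
Proof. exact: linear0. Qed.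

Lemma inner0l z : <<0, z>> = 0.
Proof. exact: linear0l. Qed.

Lemma innerl_linear (v : H) : scalar (fun x => <<x, v>>).
Proof. by move=> a x y; rewrite innerDl innerZl. Qed.

Lemma rank1_linear (u v : H) : linear (fun x => <<x, v>> *: u).
Proof. by move=> a x y; rewrite innerl_linear scalerDl scalerA. Qed.

Lemma rank1_bound (u v x : H) : `|<<x, v>> *: u| <= `|u| * `|v| * `|x|.
Proof.
rewrite normrZ mulrC -mulrA ler_wpM2l// [leRHS]mulrC.
exact: cauchy_schwarz.
Qed.

Definition rank1 (u v : H) : bop H H :=
  mk_bop (mulr_ge0 (normr_ge0 u) (normr_ge0 v)) (rank1_linear u v)
    (rank1_bound u v).

Lemma rank1E u v x : rank1 u v x = <<x, v>> *: u. Proof. by []. Qed.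

(** * The partial isometry carrying one orthonormal family to another *)

Section Transfer.
Context (I : choiceType) (e f : I -> H).
Hypotheses (oe : orthonormal_family e) (of_ : orthonormal_family f).

(** The index set may be uncountable, so the series is taken as the net of its partial sums over
    finite subsets. *)
Definition transfer_sum (x : H) (F : {fset I}) : H :=
  \sum_(i <- F) <<x, e i>> *: f i.

Lemma transfer_sum_norm x F : `|transfer_sum x F| <= `|x|.
Proof.
rewrite -(@ler_pXn2r _ 2)// ?nnegrE//.
by rewrite norm_fsum// bessel.
Qed.

(** Pythagoras: the terms indexed by [G] minus [F] are orthogonal to those indexed by [F]. *)
Lemma transfer_sumB x (F G : {fset I}) : (F `<=` G)%fset ->
  `|transfer_sum x G - transfer_sum x F| ^+ 2 =
  `|transfer_sum x G| ^+ 2 - `|transfer_sum x F| ^+ 2.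
Proof.
move=> FG; have split_ (V : nmodType) (g : I -> V) :
    \sum_(i <- G) g i = \sum_(i <- (G `\` F)%fset) g i + \sum_(i <- F) g i.
  rewrite (big_fsetID _ (mem F)) addrC; congr (_ + _); apply: eq_fbigl => i.
    by rewrite !inE /= andb_idl//; exact: (fsubsetP FG).
  by rewrite !inE /= andbC.
by rewrite !norm_fsum// /transfer_sum !split_ !addrK norm_fsum.
Qed.

(** The squared norms of the partial sums are bounded by [|x|^2]. If [F] comes within [r^2] of their
    supremum, then by [transfer_sumB] every larger [G] gives a partial sum at distance less than
    [r], so the net is Cauchy. *)
Lemma transfer_cvg x : cvg (transfer_sum x @ totally).
Proof.
apply/cauchy_cvgP/cauchy_exP => _ /posC_ex[r r0 ->].
pose A := [set rnorm (transfer_sum x F) ^+ 2 | F in setT].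
have supA : has_sup A.
  split; first by exists (rnorm (transfer_sum x fset0) ^+ 2), fset0.
  exists (rnorm x ^+ 2) => _ [F _ <-].
  rewrite ler_pXn2r ?nnegrE ?rnorm_ge0// -lecR !rnormE.
  exact: transfer_sum_norm.
have r20 : 0 < r ^+ 2 by rewrite exprn_gt0.
have [_ [F _ <-] ltF] := sup_adherent r20 supA.
exists (transfer_sum x F); exists F => //= G FG.
rewrite -ball_normE /ball_ /= distrC.
rewrite -(@ltr_pXn2r _ 2)// ?nnegrE ?ler0c ?(ltW r0)//.
rewrite transfer_sumB// -!rnormE -!rmorphXn -rmorphB ltcR ltrBlDr.
have : rnorm (transfer_sum x G) ^+ 2 <= sup A.
  by apply: ub_le_sup; [exact: supA.2|exists G].
by move=> /le_lt_trans; apply; rewrite -ltrBlDl.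
Qed.

Let T x := lim (transfer_sum x @ totally).

Lemma transfer_linear : linear T.
Proof.
move=> a x y; apply: cvg_lim; first exact: norm_hausdorff.
rewrite (_ : transfer_sum _ =
  (fun F => a *: transfer_sum x F + transfer_sum y F)); last first.
  apply/funext => F; rewrite /transfer_sum scaler_sumr -big_split.
  by apply: eq_bigr => i _; rewrite /= innerl_linear scalerDl scalerA.
by apply: cvgD; [apply: cvgZl_tmp|]; exact: transfer_cvg.
Qed.

Lemma transfer_bound x : `|T x| <= 1 * `|x|.
Proof.
rewrite mul1r -(rnormE x) -normrN -sub0r.
apply: near_dist_le (transfer_cvg (x := x)) _; apply: nearW => F.
by rewrite sub0r normrN rnormE transfer_sum_norm.
Qed.

Definition transfer : bop H H := mk_bop ler01 transfer_linear transfer_bound.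

Lemma inner_transfer x v c :
  (\forall F \near totally, <<transfer_sum x F, v>> = c) ->
  <<transfer x, v>> = c.
Proof.
move=> Fc.
have : (fun F => <<transfer_sum x F, v>>) @ totally --> <<transfer x, v>>.
  apply/cvgrPdist_lt => r r0.
  (* Adding 1 keeps the divisor positive when [v = 0]. *)
  have v0 : 0 < `|v| + 1 by rewrite ltr_wpDl.
  have rv0 : 0 < r / (`|v| + 1) by rewrite divr_gt0.
  have := transfer_cvg (x := x) => /cvgrPdist_lt/(_ _ rv0).
  apply: filterS => F xF; rewrite -innerBl.
  rewrite (le_lt_trans (cauchy_schwarz _ _))//.
  rewrite -(divfK (lt0r_neq0 v0) r).
  rewrite (@le_lt_trans _ _ (`|transfer x - transfer_sum x F| * (`|v| + 1)))//.
    by rewrite ler_wpM2l// lerDl.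
  by rewrite ltr_pM2r.
move=> /cvg_lim <-; last exact: norm_hausdorff.
apply: cvg_lim; first exact: norm_hausdorff.
by apply: cvg_near_cst; exact: Fc.
Qed.

(** The coordinate along [f j] is constant as soon as the finite set contains [j]. *)
Lemma transfer_coord x j : <<transfer x, f j>> = <<x, e j>>.
Proof.
apply: inner_transfer; exists [fset j]%fset => // F /=.
by rewrite fsub1set => jF; exact: inner_fsum.
Qed.

Lemma transfer_orth x v : (forall i, <<f i, v>> = 0) -> <<transfer x, v>> = 0.
Proof.
move=> fv; apply: inner_transfer; apply: nearW => F.
by rewrite inner_suml big1// => i _; rewrite innerZl fv mulr0.
Qed.

Lemma transfer_eq0 x : (forall i, <<x, e i>> = 0) -> transfer x = 0.
Proof.
move=> xe; have sumE F : transfer_sum x F = 0.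
  by rewrite /transfer_sum big1// => i _; rewrite xe scale0r.
apply: cvg_lim; first exact: norm_hausdorff.
by apply: cvg_near_cst; apply: nearW => F; rewrite sumE.
Qed.

End Transfer.

(** * Maximal families of orthonormal pairs *)

Definition orthonormal_pairs (E : set (H * H)) := forall p q, E p -> E q ->
  [/\ <<p.1, q.1>> = (p == q)%:R, <<p.2, q.2>> = (p == q)%:R
    & <<p.1, q.2>> = 0].

(** The condition involves two pairs at a time, and two members of the union of a chain already lie
    in one member of the chain. *)
Lemma maximal_orthonormal_pairs : exists E : set (H * H),
  orthonormal_pairs E /\ forall B, E `<` B -> ~ orthonormal_pairs B.
Proof.
apply: Zorn_bigcup => F FP Ftot p q [X FX Xp] [Y FY Yq].
by have [XY|YX] := Ftot _ _ FX FY; [apply: (FP _ FY)|apply: (FP _ FX)];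
  rewrite ?(XY _ Xp) ?(YX _ Yq) //; [exact: XY|exact: YX].
Qed.

Lemma orthonormal_pairsU (E : set (H * H)) (r v : H) :
  orthonormal_pairs E -> `|r| = 1 -> `|v| = 1 -> <<r, v>> = 0 ->
  (forall p, E p -> [/\ <<r, p.1>> = 0, <<r, p.2>> = 0,
                       <<v, p.1>> = 0 & <<v, p.2>> = 0]) ->
  orthonormal_pairs (E `|` [set (r, v)]).
Proof.
move=> oE /norm1_inner r1 /norm1_inner v1 rv Erv p q.
have neq p' : E p' -> (p' == (r, v)) = false.
  move=> Ep; apply/eqP => pE; have [+ _ _ _] := Erv _ Ep.
  by rewrite pE r1 => /eqP; rewrite oner_eq0.
move=> [Ep|->] [Eq|->].
- exact: oE.
- have [rp1 rp2 vp1 vp2] := Erv _ Ep.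
  by rewrite neq//; split; apply: inner_eq0C.
- have [rq1 rq2 vq1 vq2] := Erv _ Eq.
  by rewrite eq_sym neq.
- by rewrite eqxx.
Qed.

(** The last identity says that [1 - V U - U V] has its range in the line spanned by [r]; the value
    [r = 0] is allowed and covers the case where this operator vanishes. *)
Lemma exists_corank1_isometry : exists (U V : bop H H) (r : H),
  [/\ forall x, U (U x) = 0, U r = 0, V r = 0 &
      forall x, x - V (U x) - U (V x) = <<x - V (U x) - U (V x), r>> *: r].
Proof.
have [E [oE maxE]] := maximal_orthonormal_pairs.
pose e (p : E) : H := (val p).1; pose f (p : E) : H := (val p).2.
have EP (p : E) : E (val p) by exact: set_valP.
have oe : orthonormal_family e by move=> p q; have [] := oE _ _ (EP p) (EP q).
have of_ : orthonormal_family f by move=> p q; have [] := oE _ _ (EP p) (EP q).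
have ef p q : <<e p, f q>> = 0 by have [] := oE _ _ (EP p) (EP q).
have fe p q : <<f p, e q>> = 0 by apply: inner_eq0C.
pose U := transfer oe of_; pose V := transfer of_ oe.
pose P x := x - V (U x) - U (V x).
(* [V U] reproduces the coordinates along [e] and [U V] those along [f], so [P x] is orthogonal to
   both families. *)
have Pe x p : <<P x, e p>> = 0.
  rewrite !innerBl [<<V _, _>>]transfer_coord [<<U x, _>>]transfer_coord.
  by rewrite [<<U _, _>>]transfer_orth// subrr subr0.
have Pf x p : <<P x, f p>> = 0.
  rewrite !innerBl [<<U _, _>>]transfer_coord [<<V x, _>>]transfer_coord.
  by rewrite [<<V _, _>>]transfer_orth// subr0 subrr.
have UU x : U (U x) = 0.
  by apply: transfer_eq0 => p; apply: transfer_orth.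
exists U, V.
have [P0|/existsNP[x0 /eqP Px0]] := pselect (forall x, P x = 0).
  by exists 0; split; rewrite ?linear0// => x; rewrite [LHS]P0 scaler0.
pose r := `|P x0|^-1 *: P x0.
have r1 : `|r| = 1 by rewrite normfZV.
have re p : <<r, e p>> = 0 by rewrite innerZl Pe mulr0.
have rf p : <<r, f p>> = 0 by rewrite innerZl Pf mulr0.
exists r; split => //; [exact: transfer_eq0|exact: transfer_eq0|move=> x].
rewrite -/(P x); apply/eqP; rewrite -subr_eq0; apply/negP => /negP v0.
(* [v] is the part of [P x] orthogonal to [r]. If it were nonzero, the pair of [r] and the
   normalized [v] could be adjoined to [E], against maximality. *)
set v := _ - _ in v0; pose u := `|v|^-1 *: v.
have u1 : `|u| = 1 by rewrite normfZV.
have vr : <<v, r>> = 0.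
  by rewrite innerBl innerZl norm1_inner// mulr1 subrr.
have ve p : <<v, e p>> = 0 by rewrite innerBl innerZl Pe re mulr0 subrr.
have vf p : <<v, f p>> = 0 by rewrite innerBl innerZl Pf rf mulr0 subrr.
have ru : <<r, u>> = 0 by apply: inner_eq0C; rewrite innerZl vr mulr0.
have Eru p : E p -> [/\ <<r, p.1>> = 0, <<r, p.2>> = 0,
                       <<u, p.1>> = 0 & <<u, p.2>> = 0].
  move=> Ep; pose p' : E := exist _ p (mem_set Ep).
  split; [exact: (re p')|exact: (rf p')| |].
    by rewrite innerZl (ve p') mulr0.
  by rewrite innerZl (vf p') mulr0.
apply: (maxE (E `|` [set (r, u)])); last exact: orthonormal_pairsU.
split; first by move=> p Ep; left.
(* The enlargement is strict: were [(r, u)] in [E], the unit vector [r] would be orthogonal to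
   itself. *)
move=> /(_ (r, u) (or_intror erefl)) /Eru[/= + _ _ _].
by rewrite norm1_inner// => /eqP; rewrite oner_eq0.
Qed.

(** * The identity operator and the characters of B(H) *)

Lemma id_bound (x : H) : `|x| <= 1 * `|x|. Proof. by rewrite mul1r. Qed.

Lemma id_linear : linear (@id H). Proof. by []. Qed.

Definition bop_id : bop H H := mk_bop ler01 id_linear id_bound.

Lemma character_space_operator_alg : infinite_dimensional H ->
  character_space (operator_alg H) = set0.
Proof.
move=> infH; rewrite -subset0 => phi [philin phiM [a phia]].
have phiD (S T : bop H H) : phi (S + T) = phi S + phi T.
  by have := philin 1 S T; rewrite scale1r mul1r.
have phiC (S T : bop H H) : phi (bop_comp S T) = phi S * phi T by exact: phiM.
have phi0 : phi 0 = 0.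
  by have := phiD 0 0; rewrite addr0 => /esym/(canRL (addrK _)); rewrite subrr.
have phiN (N : bop H H) : (forall x, N (N x) = 0) -> phi N = 0.
  move=> NN; have : phi (bop_comp N N) = 0.
    by rewrite -phi0; congr phi; apply: bop_ext.
  by rewrite phiC => /eqP; rewrite mulf_eq0 orbb => /eqP.
have [U [V [r [UU Ur Vr Pr]]]] := exists_corank1_isometry.
pose P : bop H H := bop_id - bop_comp V U - bop_comp U V.
have PE x : P x = <<P x, r>> *: r by exact: Pr.
have Px x : P x = x - V (U x) - U (V x) by [].
have Prr : P r = r.
  by rewrite Px Ur Vr !bop_map0 !subr0.
(* Infinite dimension enters here: [r] alone cannot span [H]. Removing [P s] from [s] then gives a
   nonzero [w] in the kernel of [P]. *)
have [s sr] : exists s : H, forall c, s <> c *: r.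
  apply/not_existsP => spanr; apply: infH; exists 1%N, (fun=> r) => x.
  have /existsNP[c /contrapT xE] := spanr x.
  by exists (fun=> c); rewrite big_ord1.
pose w := s - P s.
have w0 : w != 0 by rewrite subr_eq0 PE; apply/eqP/sr.
have Pw : P w = 0.
  have PPs : P (P s) = P s by rewrite (PE s) bop_mapZ Prr.
  by rewrite bop_mapB PPs subrr.
have phiP : phi P = 0.
  (* The range of this operator lies on the line of [w], which [P] kills, so its square is zero. *)
  have N0 : phi (bop_comp (rank1 w r) P) = 0.
    apply: phiN => x; rewrite !bop_compE !rank1E bop_mapZ Pw.
    by rewrite scaler0 inner0l scale0r.
  (* The inner factor sends [x] to [<<P x, r>> *: w]; the outer one sends [w] back to [r], whence
     the factor [<<w, w>>^-1]. *)
  have -> : P = bop_comp (rank1 ((<<w, w>>)^-1 *: r) w)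
                         (bop_comp (rank1 w r) P).
    apply: bop_ext => x; rewrite !bop_compE !rank1E innerZl scalerA.
    by rewrite mulfK ?dnorm_eq0// -PE.
  by rewrite phiC N0 mulr0.
have U0 : phi U = 0 by exact: phiN.
have id0 : phi bop_id = 0.
  have -> : bop_id = P + bop_comp U V + bop_comp V U by rewrite !subrK.
  by rewrite 2!phiD phiP !phiC U0 mul0r mulr0 !addr0.
have aE : a = bop_comp bop_id a by exact: (@bop_ext R H H).
by move: phia; rewrite aE phiC id0 mul0r eqxx.
Qed.

End Hilbert.

(** * Units and characters of iterated biduals *)

Section Unital.
Context (R : realType).
Implicit Types A : banachAlg R.

Definition unit_of A (e : A) :=
  (forall a, bmul e a = a) /\ (forall a, bmul a e = a).

Section Canonical.
Context (A : banachAlg R).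

Lemma eval_linear (a : A) : scalar (fun f : dual A => f a).
Proof. by []. Qed.

Lemma eval_bound (a : A) (f : dual A) : `|f a| <= `|a| * `|f|.
Proof. by rewrite mulrC ler_bop. Qed.

(** The canonical embedding of [A] into its bidual. *)
Definition bidual_inj (a : A) : dual (dual A) :=
  mk_bop (normr_ge0 a) (eval_linear a) (eval_bound a).

Lemma bidual_inj_linear : linear bidual_inj.
Proof.
by move=> c a b; apply: dual_ext => f; rewrite dual_linE [LHS]linearP.
Qed.

Lemma bidual_injM a b :
  arens (bidual_inj a) (bidual_inj b) = bidual_inj (bmul a b).
Proof. exact: dual_ext. Qed.

Lemma unit_of_bidual (e : A) :
  unit_of e -> @unit_of (bidual_alg A) (bidual_inj e).
Proof.
move=> [el er]; split=> Phi; apply: dual_ext => f; rewrite [LHS]arensE.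
  rewrite [LHS]/(Phi _); congr (Phi _); apply: dual_ext => a.
  by rewrite dual_ractE /= el.
by congr (Phi _); apply: dual_ext => a; rewrite arens_actE [LHS]/(f _) /= er.
Qed.

(** A character of the bidual restricts along the canonical embedding. The restriction is nonzero:
    the image of [e] is a unit, so a character vanishing there vanishes everywhere. *)
Lemma character_space_bidual (e : A) : unit_of e ->
  character_space A = set0 -> character_space (bidual_alg A) = set0.
Proof.
move=> /unit_of_bidual[el er] A0.
rewrite -subset0 => phi [philin phiM [Phi phi0]].
suff : character_space A (phi \o bidual_inj) by rewrite A0.
split => [c a b|a b|].
- by rewrite /= bidual_inj_linear philin.
- by rewrite /= -bidual_injM [LHS]phiM.
- exists e; apply/eqP => /= e0; move/eqP: phi0; apply.
  by rewrite -(el Phi) phiM e0 mul0r.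
Qed.

End Canonical.

Lemma character_space_even_dual A (e : A) n : unit_of e ->
  character_space A = set0 -> character_space (even_dual_alg A n) = set0.
Proof.
(* The induction carries a unit along, since each passage to the bidual uses one. *)
move=> ue A0; suff [] : (exists e : even_dual_alg A n, unit_of e) /\
    character_space (even_dual_alg A n) = set0 by [].
elim: n => [|n [[e' ue'] An]]; first by split; [exists e|].
split; first by exists (bidual_inj e'); exact: unit_of_bidual.
exact: character_space_bidual ue' An.
Qed.

(** * Characters of module extensions *)

Lemma linear_zero (V W : lmodType R[i]) (g : V -> W) : linear g -> g 0 = 0.
Proof. by move=> /(_ (-1) 0 0); rewrite scaler0 addr0 scaleN1r addNr. Qed.

Lemma character_space_module_ext A (X : banachBimod A) :
  character_space A = set0 -> character_space (module_ext X) = set0.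
Proof.
move=> A0; rewrite -subset0 => phi [philin phiM [[a u] phi_au]].
have phiD (p q : l1sum A X) : phi (p + q) = phi p + phi q.
  by have := philin 1 p q; rewrite scale1r mul1r.
have phi0 : phi (0 : l1sum A X) = 0.
  by have := philin (-1) 0 0; rewrite scaler0 addr0 mulN1r addNr.
(* [(0, v)] squares to zero, so [phi] depends only on the first component and restricts to a
   character of [A]. *)
have phi_nil (v : X) : phi ((0, v) : l1sum A X) = 0.
  have : phi (ext_mul ((0, v) : l1sum A X) (0, v)) = 0.
    rewrite -phi0; congr phi; apply: (@l1_ext R A X).
      by rewrite ext_mul1 (linear_zero (bmul_linearr _)).
    rewrite ext_mul2 (linear_zero (lact_linearl _)).
    by rewrite (linear_zero (ract_linearr _)) addr0.
  by rewrite [LHS]phiM => /eqP; rewrite mulf_eq0 orbb => /eqP.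
suff : character_space A (fun b => phi ((b, 0) : l1sum A X)) by rewrite A0.
split => [c b b'|b b'|].
- rewrite -philin; congr phi; apply: (@l1_ext R A X) => //.
  by rewrite l1_lin2 scaler0 addr0.
- rewrite -[RHS]phiM; congr phi; apply: (@l1_ext R A X) => //.
  rewrite [RHS]ext_mul2 (linear_zero (lact_linearr _)).
  by rewrite (linear_zero (ract_linearl _)) addr0.
(* Splitting [(a, u)] as [(a, 0) + (0, u)] shows that the restriction is nonzero at [a]. *)
- exists a; suff <- : phi ((a, u) : l1sum A X) = phi ((a, 0) : l1sum A X) by [].
  rewrite -[RHS]addr0 -(phi_nil u) -phiD; congr phi.
  by apply: (@l1_ext R A X); rewrite /= ?addr0 ?add0r.
Qed.

End Unital.

Theorem corollary2p10 (R : realType) (H : hilbertSpace R) (n : nat)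
    (H_infdim : infinite_dimensional H) :
  character_space (even_dual_alg (operator_alg H) n) = set0 /\
  character_space (module_ext (dual_bimod_iter (operator_alg H) (2 * n))) = set0.
Proof.
have BH0 := character_space_operator_alg H_infdim.
have unit_id : @unit_of R (operator_alg H) (bop_id H).
  by split=> S; exact: bop_ext.
split; first exact: character_space_even_dual unit_id BH0.
exact: character_space_module_ext.
Qed.
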